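(* Let $k$ be a positive integer, and let $n$ be the smallest $k$-layered number, with prime factorization $n=p_1^{\alpha_1}p_2^{\alpha_2}\cdots p_m^{\alpha_m}$, where $m\ge 1$, $p_1<p_2<\cdots<p_m$ are primes and the $\alpha_i$ are positive integers. Then $(L_{max}(p_1,p_2,\dots,p_m)+1)\,n$ is an upper bound for the difference of two consecutive $k$-layered numbers; that is, if $a<b$ are consecutive $k$-layered numbers, then $b-a\le (L_{max}(p_1,\dots,p_m)+1)\,n$.
   Context: A positive integer $n$ is $k$-layered if the set of all positive divisors of $n$ can be partitioned into $k$ subsets having the same sum of elements (it is assumed that a $k$-layered number exists for the given $k$). Two $k$-layered numbers $a<b$ are consecutive if no integer strictly between them is $k$-layered. For distinct primes $p_1<\dots<p_m$, a chain of consecutive positive integers $a,a+1,\dots,a+z$ is a $(p_1,\dots,p_m)$-gcd chain if $\gcd(a+j,p_1p_2\cdots p_m)\ne 1$ for every $0\le j\le z$. $L_{max}(p_1,\dots,p_m)$ denotes the largest number of terms of a $(p_1,\dots,p_m)$-gcd chain (the maximum being over all starting points $a$ and all lengths). *)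

(* Defs.v *)
From mathcomp Require Import boolp classical_sets.
From mathcomp Require Import all_boot.

Set Implicit Arguments.
Unset Strict Implicit.
Unset Printing Implicit Defensive.

(* The blocks of a [partition] are nonempty; this is automatic for k subsets
   with equal sums, since the divisors of n > 0 have a positive sum. *)
Definition layered (k n : nat) : Prop :=
  0 < n /\
  exists P : {set {set 'I_n.+1}},
    [/\ finset.partition P [set d : 'I_n.+1 | d %| n],
        #|P| = k
      & forall A B : {set 'I_n.+1}, A \in P -> B \in P ->
          \sum_(d in A) (d : nat) = \sum_(d in B) (d : nat)].

Definition smallest_layered (k n : nat) : Prop :=
  layered k n /\ forall l : nat, layered k l -> n <= l.

Definition consecutive_layered (k a b : nat) : Prop :=
  [/\ layered k a, layered k b, a < b
    & forall c : nat, a < c < b -> ~ layered k c].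

(* The chain a, a + 1, ..., a + z has z.+1 terms. *)
Definition gcd_chain (m : nat) (p : 'I_m -> nat) (a z : nat) : Prop :=
  0 < a /\ forall j : nat, j <= z -> gcdn (a + j) (\prod_(i < m) p i) <> 1.

Definition is_Lmax (m : nat) (p : 'I_m -> nat) (L : nat) : Prop :=
  (exists a z : nat, gcd_chain p a z /\ z.+1 = L) /\
  (forall a z : nat, gcd_chain p a z -> z.+1 <= L).

(* [xget] defaults to 0 when no maximum exists; [LmaxP] shows that this does
   not happen for a nonempty family of primes. *)
Definition Lmax (m : nat) (p : 'I_m -> nat) : nat :=
  xget 0 (is_Lmax p : classical_sets.set nat).

Lemma gcd_chain_bounded (m : nat) (p : 'I_m -> nat) (a z : nat) :
  (forall i, prime (p i)) -> gcd_chain p a z -> z.+1 <= \prod_(i < m) p i.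
Proof.
move=> pr_p [_ ch]; set P := \prod_(i < m) p i in ch *.
have P_gt0 : 0 < P by apply: prodn_gt0 => i; exact: prime_gt0.
rewrite leqNgt; apply/negP => ltPz.
pose j := P - a %% P.
have le_jz : j.+1 <= z.+1 by apply: leq_ltn_trans ltPz; exact: leq_subr.
have dvd_aj : P %| a + j.
  have -> : a + j = (a %/ P).+1 * P.
    rewrite /j {1}(divn_eq a P) -addnA subnKC ?mulSn 1?addnC //.
    exact/ltnW/ltn_pmod.
  exact: dvdn_mull.
have j_gt0 : 0 < j by rewrite subn_gt0 ltn_pmod.
apply: (ch j.-1); first by rewrite -ltnS prednK // ltnW.
have -> : a + j.-1 = (a + j).-1 by rewrite -(prednK j_gt0) addnS.
apply/eqP; apply: coprime_dvdr dvd_aj _.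
by rewrite coprime_sym coprimenP ?addn_gt0 ?j_gt0 ?orbT.
Qed.

Lemma LmaxP (m : nat) (p : 'I_m -> nat) :
  0 < m -> (forall i, prime (p i)) -> is_Lmax p (Lmax p).
Proof.
case: m p => // m p _ pr_p.
pose Q L := `[< exists a z, gcd_chain p a z /\ z.+1 = L >].
have exQ : exists L, Q L.
  exists 1; apply/asboolP; exists (p ord0), 0; split=> //.
  split=> [|j]; first exact: prime_gt0.
  rewrite leqn0 => /eqP ->; rewrite addn0 big_ord_recl.
  have /gcdn_idPl -> : p ord0 %| p ord0 * \prod_(i < m) p (lift ord0 i).
    exact: dvdn_mulr.
  by move=> p1; have := prime_gt1 (pr_p ord0); rewrite p1.
have ubQ L : Q L -> L <= \prod_(i < m.+1) p i.
  by move=> /asboolP[a [z [ch <-]]]; exact: gcd_chain_bounded ch.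
rewrite /Lmax; case: xgetP => [L _ //|/(_ (ex_maxn exQ ubQ)) []].
case: ex_maxnP => L /asboolP QL maxL; split=> // a z ch.
by apply: maxL; apply/asboolP; exists a, z.
Qed.

(* Main.v *)
Require Import Defs.
From mathcomp Require Import all_boot.

(** If t is coprime to n, then n * t is k-layered whenever n is: each divisor of
n * t is uniquely d * s with d %| n and s %| t, and grouping the divisors by the
class of d multiplies all the class sums by sigma(t). Among any Lmax + 1
consecutive integers t following a %/ n one is coprime to n, which gives a
k-layered number n * t in (a, a + (Lmax + 1) n]. *)

Lemma inord_gcdn (e n : nat) :
  0 < n -> (inord (gcdn e n) : 'I_n.+1) = gcdn e n :> nat.
Proof. by move=> n0; rewrite inordK // ltnS dvdn_leq // dvdn_gcdr. Qed.

(** The maps [(d, s) |-> d * s] and [e |-> (gcdn e n, gcdn e t)] are inverse bijections between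
    pairs of divisors of [n] and [t] and divisors of [n * t], so the sum factors. *)
Lemma sum_mul_coprime_divisors (n t : nat) (A : {set 'I_n.+1}) :
  0 < n -> 0 < t -> coprime n t -> A \subset [set d : 'I_n.+1 | d %| n] ->
  \sum_(e : 'I_(n * t).+1 | (e %| n * t) && (inord (gcdn e n) \in A)) (e : nat)
  = (\sum_(d in A) (d : nat)) * \sum_(s : 'I_t.+1 | s %| t) (s : nat).
Proof.
move=> n0 t0 co_nt /subsetP sAD.
have gcdK d s : d %| n -> s %| t -> gcdn (d * s) n = d /\ gcdn (d * s) t = s.
  move=> dn st; rewrite !(gcdnC (d * s)); split.
    rewrite Gauss_gcdl; first exact/gcdn_idPr.
    exact: coprime_dvdr st co_nt.
  rewrite Gauss_gcdr; first exact/gcdn_idPr.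
  by rewrite coprime_sym (coprime_dvdl dn co_nt).
have nt0 : 0 < n * t by rewrite muln_gt0 n0.
rewrite big_distrlr /= pair_big /=.
pose h (x : 'I_n.+1 * 'I_t.+1) : 'I_(n * t).+1 := inord (x.1 * x.2).
pose h' (e : 'I_(n * t).+1) : 'I_n.+1 * 'I_t.+1 :=
  (inord (gcdn e n), inord (gcdn e t)).
have hE (x : 'I_n.+1 * 'I_t.+1) : h x = x.1 * x.2 :> nat.
  by rewrite inordK // ltnS leq_mul // -ltnS.
rewrite (reindex_onto h h') => [|e /andP[ent _]]; last first.
  apply: ord_inj; rewrite hE /= !inord_gcdn //.
  apply/eqP; rewrite eqn_dvd; apply/andP; split.
    rewrite Gauss_dvd ?dvdn_gcdl //.
    by rewrite (coprime_dvdl (dvdn_gcdr _ _)) ?(coprime_dvdr (dvdn_gcdr _ _)).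
  (* Expanded, the product of the two gcds is the gcd of [e * e], [n * e], [e * t] and [n * t], all
     multiples of [e]. *)
  rewrite muln_gcdr !muln_gcdl !dvdn_gcd ent.
  by rewrite !(dvdn_mulr _ (dvdnn e)) (dvdn_mull _ (dvdnn e)).
apply: eq_big => [[d s]|x _]; last exact: hE.
rewrite hE /=; apply/andP/andP => [[/andP[ent dA] /eqP []]|[dA st]].
  rewrite hE /= => dE sE; rewrite dE in dA; split=> //.
  by rewrite -sE inord_gcdn // dvdn_gcdr.
have dn : d %| n by have := sAD _ dA; rewrite inE.
have [g1 g2] := gcdK _ _ dn st.
by rewrite /h' hE /= g1 g2 !inord_val dA dvdn_mul.
Qed.

Lemma layered_mul_coprime (k n t : nat) :
  0 < t -> coprime n t -> layered k n -> layered k (n * t).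
Proof.
move=> t0 co_nt [n0 [P [partP cardP sumP]]].
have nt0 : 0 < n * t by rewrite muln_gt0 n0.
split=> //.
have sPD A : A \in P -> A \subset [set d : 'I_n.+1 | d %| n].
  by move=> AP; rewrite -(cover_partition partP); exact: bigcup_sup.
pose F (A : {set 'I_n.+1}) :=
  [set e : 'I_(n * t).+1 | (e %| n * t) && (inord (gcdn e n) \in A)].
have P0 : set0 \notin P by case/and3P: partP.
(* Any [d] in [A] lies in [F A] as well, since [gcdn d n = d]. *)
have F0 : set0 \notin F @: P.
  apply/imsetP => -[A AP].
  have /set0Pn[d dA] : A != set0 by apply: contraNneq P0 => <-.
  have := subsetP (sPD A AP) d dA; rewrite inE => dn.
  move/setP/(_ (inord d)); rewrite !inE inordK; last first.
    by rewrite ltnS dvdn_leq // dvdn_mulr.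
  by rewrite (gcdn_idPl dn) inord_val dA dvdn_mulr.
(* Distinct classes have disjoint images, because [gcdn e n] lies in only one class; as no image is
   empty, [F] is injective and the number of classes stays [k]. *)
have [tF injF] : trivIset (F @: P) /\ {in P &, injective F}.
  apply: trivIimset F0 => A B AP BP neqBA.
  rewrite -setI_eq0 -subset0; apply/subsetP => e; rewrite !inE.
  case/andP=> /andP[_ eA] /andP[_ eB].
  have /trivIsetP/(_ _ _ AP BP) : trivIset P by case/and3P: partP.
  by rewrite eq_sym neqBA => /(_ isT)/disjointFr/(_ eA); rewrite eB.
exists (F @: P); split; last 1 first.
- move=> _ _ /imsetP[A AP ->] /imsetP[B BP ->].
  rewrite !(eq_bigl _ _ (fun e => in_set _ e)).
  rewrite !sum_mul_coprime_divisors ?sPD //.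
  by rewrite (sumP A B).
- apply/and3P; split=> //.
  rewrite cover_imset; apply/eqP/setP => e; rewrite inE.
  apply/bigcupP/idP => [[A _]|ent]; first by rewrite inE => /andP[].
  have : (inord (gcdn e n) : 'I_n.+1) \in cover P.
    by rewrite (cover_partition partP) inE inord_gcdn // dvdn_gcdr.
  by case/bigcupP=> A AP eA; exists A; rewrite // inE ent.
- by rewrite card_in_imset.
Qed.

(** Otherwise [c, ..., c + Lmax p] would be a gcd chain with [Lmax p + 1] terms. *)
Lemma Lmax_coprime (m : nat) (p : 'I_m -> nat) (c : nat) :
  0 < m -> (forall i, prime (p i)) -> 0 < c ->
  exists2 j, j <= Lmax p & coprime (c + j) (\prod_(i < m) p i).
Proof.
move=> m0 pr_p c0; have [_ maxL] := LmaxP m0 pr_p.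
have [/existsP[j co_j]|/existsPn nco] := boolP
    [exists j : 'I_(Lmax p).+1, coprime (c + j) (\prod_(i < m) p i)].
  by exists j; rewrite // -ltnS.
suff /maxL : gcd_chain p c (Lmax p) by rewrite ltnn.
split=> // j; rewrite -ltnS => jL /eqP co_j.
by have /negP := nco (Ordinal jL).
Qed.

Theorem proposition8p8 (k n m : nat) (p alpha : 'I_m -> nat)
  (hk : 0 < k) (hn : smallest_layered k n)
  (hm : 0 < m)
  (hp : forall i : 'I_m, prime (p i))
  (hlt : forall i j : 'I_m, i < j -> p i < p j)
  (halpha : forall i : 'I_m, 0 < alpha i)
  (hfact : n = \prod_(i < m) p i ^ alpha i)
  (a b : nat) (hab : consecutive_layered k a b) :
  b - a <= (Lmax p + 1) * n.
Proof.
have [lay_n _] := hn; have [n0 _] := lay_n; have [_ _ _ gap] := hab.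
(* The search starts at [(a %/ n).+1] because [n] times it is the first multiple of [n] above
   [a]. *)
have [j jL co_j] := @Lmax_coprime m p (a %/ n).+1 hm hp isT.
set t := _ + j in co_j.
have co_nt : coprime n t.
  rewrite hfact; apply: (big_ind (coprime^~ t)) => [|x y xt yt|i _].
  - exact: coprime1n.
  - by rewrite coprimeMl xt.
  - apply: coprimeXl; rewrite coprime_sym; apply: coprime_dvdr co_j.
    by rewrite (bigD1 i) //= dvdn_mulr.
have lay_nt : layered k (n * t) by exact: layered_mul_coprime.
have lt_a : a < n * t.
  by rewrite (leq_trans (ltn_ceil a n0)) // mulnC leq_mul2l leq_addr orbT.
have le_b : b <= n * t.
  by rewrite leqNgt; apply/negP => lt_b; apply: (gap (n * t)); rewrite ?lt_a.
(* Here [n * t] splits as [(a %/ n) * n + j.+1 * n], with first term at most [a] and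
   [j <= Lmax p]. *)
rewrite leq_subLR (leq_trans le_b) // /t mulnC addSnnS mulnDl.
by rewrite leq_add ?leq_divM // leq_mul2r addn1 ltnS jL orbT.
Qed.
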